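(* Let $M$ be an arbitrary simplicial complex and let $K \supset L$ be a pair of simplicial complexes. Suppose that $K, L$ satisfy the following three conditions: (1) $K$ is shellable; (2) $\mathbf{F}_L \subset \mathbf{F}_K$; (3) there exists a shelling $<_K$ on $K$ such that $\tau <_K \sigma$ for any $\tau \in \mathbf{F}_L$ and any $\sigma \in \mathbf{F}_K \setminus \mathbf{F}_L$. Then $\mathcal{Z}^*_M(K,L)$ is shellable.
   Context: A simplicial complex $K$ is a collection of finite subsets (simplices) of a set $V(K)$ closed under taking subsets, with $\{v\}\in K$ for all $v\in V(K)$. The dimension is $\dim K=\max_{\sigma\in K}|\sigma|-1$; all simplicial complexes are nonempty (they contain $\emptyset$) and finite-dimensional. A facet is an inclusion-maximal simplex; $\mathbf{F}_X$ denotes the set of all facets of $X$. A complex is pure if all its facets have the same cardinality. A pair of simplicial complexes $K\supset L$ consists of a simplicial complex $K$ and a subcomplex $L$ of $K$ (so $V(L)\subset V(K)$). $K$ is shellable (in the non-pure sense) if its facets can be arranged in a linear order $F_1,\dots,F_t$ (a shelling) such that for all $k=2,\dots,t$ the subcomplex $\left(\bigcup_{i=1}^{k-1}\langle F_i\rangle\right)\cap\langle F_k\rangle$ is pure and $(|F_k|-2)$-dimensional, where $\langle F\rangle$ is the complex of all subsets of $F$. A shelling is also regarded as a linear order relation on the set of facets. The join of $K_1,\dots,K_m$ is $K_1*\cdots*K_m=\{\sigma\subset\bigsqcup_{i}V(K_i) : \sigma\cap V(K_i)\in K_i \text{ for all } i\}$. Let $M$ be a simplicial complex with vertex set $V(M)=[m]=\{1,\dots,m\}$,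 $m\ge1$. The polyhedral join is the subcomplex $\mathcal{Z}^*_M(K,L)=\bigcup_{S\in M}X^S_1*\cdots*X^S_m$ of the join of $m$ disjoint copies of $K$, where $X^S_i$ is the $i$-th copy of $K$ if $i\in S$ and the $i$-th copy of $L$ if $i\notin S$. *)

(* Defs.v *)
From HB Require Import structures.
From mathcomp Require Import all_boot all_order all_algebra finmap.
From mathcomp Require Import all_classical.

Set Implicit Arguments.
Unset Strict Implicit.
Unset Printing Implicit Defensive.

Import Order.TTheory GRing.Theory Num.Theory.

Local Open Scope classical_set_scope.

(* The vertex set is not a field: since there are no ghost vertices, it is
   recovered as [vertices K] below. *)
Record complex (T : choiceType) := Complex {
  simplices :> set {fset T};
  complex_fset0 : simplices fset0;
  complex_sub : forall s t : {fset T},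
    (t `<=` s)%fset -> simplices s -> simplices t;
  complex_findim : exists n : nat,
    forall s : {fset T}, simplices s -> (#|` s| <= n)%N
}.

Definition vertices (T : choiceType) (K : complex T) : set T :=
  [set v | simplices K [fset v]%fset].

Section FacetsAndShellings.
Variable T : choiceType.
Implicit Types (X : set {fset T}) (F G s t : {fset T}) (K : complex T).

Definition facets X : set {fset T} :=
  [set F | X F /\ forall G, X G -> (F `<=` G)%fset -> G = F].

Definition pure X : Prop :=
  forall F G, facets X F -> facets X G -> #|` F| = #|` G|.

(* Integer-valued, as the complex whose only simplex is the empty set has
   dimension -1. *)
Definition has_dim X (d : int) : Prop :=
  (exists2 s, X s & (#|` s|%:Z - 1 = d)%R) /\
  (forall s, X s -> (#|` s|%:Z - 1 <= d)%R).

Definition full_simplex F : set {fset T} := [set s | (s `<=` F)%fset].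

(* [Fs] lists the facets as F_1, ..., F_t; position k (from 0) holds F_(k+1). *)
Definition shelling K (Fs : seq {fset T}) : Prop :=
  [/\ uniq Fs,
      forall F, F \in Fs <-> facets K F &
      forall k : nat, (0 < k < size Fs)%N ->
        let Fk := nth fset0 Fs k in
        let X := (\bigcup_(i in `I_k) full_simplex (nth fset0 Fs i))
                 `&` full_simplex Fk in
        pure X /\ has_dim X (#|` Fk|%:Z - 2)%R].

Definition shelling_lt (Fs : seq {fset T}) F G : Prop :=
  (index F Fs < index G Fs)%N.

Definition shellable K : Prop := exists Fs, shelling K Fs.

End FacetsAndShellings.

Section Join.
Variables (T : choiceType) (m : nat).

(* The disjoint union of m copies of T is ['I_m * T]; [slice i s] is the part
   of s in the i-th copy, seen as a subset of T. *)
Definition slice (i : 'I_m) (s : {fset 'I_m * T}) : {fset T} :=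
  [fset p.2 | p in s & p.1 == i]%fset.

Lemma in_slice i (s : {fset 'I_m * T}) v : (v \in slice i s) = ((i, v) \in s).
Proof.
apply/imfsetP/idP => [[[j w]]|iv_s]; last by exists (i, v); rewrite //= inE iv_s /=.
by rewrite /= inE /= => /andP[jw_s /eqP <-] ->.
Qed.

Lemma slice0 i : slice i fset0 = fset0.
Proof. by apply/fsetP => v; rewrite in_slice !inE. Qed.

Lemma slice_sub i (s t : {fset 'I_m * T}) :
  (t `<=` s)%fset -> (slice i t `<=` slice i s)%fset.
Proof. by move=> /fsubsetP ts; apply/fsubsetP => v; rewrite !in_slice; exact: ts. Qed.

Lemma card_slices (s : {fset 'I_m * T}) : (#|` s| <= \sum_i #|` slice i s|)%N.
Proof.
pose r := [seq (i, v) | i <- enum 'I_m, v <- enum_fset (slice i s)].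
have -> : (\sum_i #|` slice i s| = size r)%N.
  by rewrite size_allpairs_dep sumnE big_map big_enum.
apply: uniq_leq_size => [|[i v] iv_s]; first exact: fset_uniq.
apply/allpairsPdep; exists i, v; split; rewrite ?mem_enum //.
by have := in_slice i s v; rewrite iv_s.
Qed.

Definition join_simplices (X : 'I_m -> complex T) : set {fset 'I_m * T} :=
  [set s | forall i, simplices (X i) (slice i s)].

Lemma join_fset0 X : join_simplices X fset0.
Proof. by move=> i; rewrite slice0; exact: complex_fset0. Qed.

Lemma join_sub X (s t : {fset 'I_m * T}) :
  (t `<=` s)%fset -> join_simplices X s -> join_simplices X t.
Proof. by move=> ts Xs i; apply: complex_sub (Xs i); exact: slice_sub. Qed.

Lemma join_findim X : exists n : nat,
  forall s, join_simplices X s -> (#|` s| <= n)%N.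
Proof.
have [n nP] := choice (fun i => complex_findim (X i)).
exists (\sum_i n i)%N => s Xs; apply: leq_trans (card_slices s) _.
by apply: leq_sum => i _; apply: nP; exact: Xs.
Qed.

Definition join (X : 'I_m -> complex T) : complex ('I_m * T)%type :=
  Complex (@join_fset0 X) (@join_sub X) (@join_findim X).

Variables (M : complex 'I_m) (K L : complex T).

Definition polyjoin_simplices : set {fset 'I_m * T} :=
  \bigcup_(S in simplices M)
    simplices (join (fun i => if i \in S then K else L)).

Lemma polyjoin_fset0 : polyjoin_simplices fset0.
Proof. by exists fset0; [exact: complex_fset0|exact: complex_fset0]. Qed.

Lemma polyjoin_sub (s t : {fset 'I_m * T}) :
  (t `<=` s)%fset -> polyjoin_simplices s -> polyjoin_simplices t.
Proof. by move=> ts [S MS Xs]; exists S => //; exact: complex_sub ts Xs. Qed.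

Lemma polyjoin_findim : exists n : nat,
  forall s, polyjoin_simplices s -> (#|` s| <= n)%N.
Proof.
have [nK nKP] := complex_findim K; have [nL nLP] := complex_findim L.
exists (\sum_(i < m) maxn nK nL)%N => s [S _ Xs].
apply: leq_trans (card_slices s) _; apply: leq_sum => i _.
rewrite leq_max; apply/orP; have := Xs i.
by case: ifP => _ ?; [left; exact: nKP|right; exact: nLP].
Qed.

Definition polyjoin : complex ('I_m * T)%type :=
  Complex polyjoin_fset0 polyjoin_sub polyjoin_findim.

End Join.

(* Main.v *)
(** Facets of the polyhedral join are the tuples of facets of [K] whose set of
    coordinates outside [L] lies in [M].  Order them by any linear extension of
    the componentwise shelling order; here the sum of the positions is used.
    If [F'] precedes [F], then [F'_i] precedes [F_i] for some [i], and replacing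
    [F_i] by the facet provided by the shelling of [K] yields an earlier tuple
    meeting [F] in codimension one.  Since the facets of [L] come first, this
    exchange never leaves [L] in coordinate [i], so the new tuple is still a
    facet of the join. *)
Require Import Defs.
From mathcomp Require Import all_boot all_order all_algebra finmap.
From mathcomp Require Import all_classical.
From mathcomp Require Import zify.

Set Implicit Arguments.
Unset Strict Implicit.
Unset Printing Implicit Defensive.

Local Open Scope classical_set_scope.

(** * Shellings as an exchange property of the list of facets *)

Section ShellingCriterion.
Variable T : choiceType.
Implicit Types (X : set {fset T}) (K L : complex T) (F G s : {fset T}).

Lemma ex_facet X n s : (forall t, X t -> (#|` t| <= n)%N) -> X s ->
  exists2 F, facets X F & (s `<=` F)%fset.
Proof.
(* Induction on the room left below the bound: a simplex that is not a facet can be enlarged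
   strictly. *)
move=> Xn; have [d] := ubnP (n - #|` s|); elim: d s => // d IHd s sd Xs.
have [sF|] := pselect (facets X s); first by exists s.
move=> /not_andP[//|/existsNP[t /not_implyP[Xt /not_implyP[st /eqP ts]]]].
have lt_st : (#|` s| < #|` t|)%N.
  by apply: fproper_ltn_card; rewrite fproperEneq eq_sym ts.
have [|F FX tF] := IHd t _ Xt; first by have := Xn t Xt; lia.
by exists F => //; exact: fsubset_trans tF.
Qed.

Lemma ex_complex_facet K s : simplices K s -> exists2 F, facets K F & (s `<=` F)%fset.
Proof. by have [n Kn] := complex_findim K; exact: ex_facet Kn. Qed.

Lemma facets_subset X Y F : Y `<=` X -> facets X F -> Y F -> facets Y F.
Proof. by move=> YX [_ Fmax] YF; split=> // G /YX; exact: Fmax. Qed.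

(** The dimension-free form of shellability: [F_i] meets [F_k] inside a codimension-one face of
    [F_k] already covered by an earlier [F_j]. *)
Definition shelling_exchange (Fs : seq {fset T}) : Prop :=
  forall i k, (i < k < size Fs)%N -> exists j v,
    [/\ (j < k)%N, v \in nth fset0 Fs k, v \notin nth fset0 Fs i &
        (nth fset0 Fs k `\ v `<=` nth fset0 Fs j)%fset].

(** The intersection of [F_i] and [F_k] extends to a facet [g] of the pure complex [X]; purity
    forces [g] to be [F_k] minus one vertex. *)
Lemma shelling_has_exchange K Fs : shelling K Fs -> shelling_exchange Fs.
Proof.
move=> [_ _ Fs_shell] i k /andP[ik kFs].
have k_range : (0 < k < size Fs)%N by rewrite kFs andbT; case: k ik {kFs}.
pose Fk := nth fset0 Fs k.
pose X := (\bigcup_(i in `I_k) full_simplex (nth fset0 Fs i)) `&` full_simplex Fk.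
have [X_pure [[s Xs s_card] X_dim]] : pure X /\ has_dim X (#|` Fk|%:Z - 2)%R.
  exact: Fs_shell k_range.
have X_le t : X t -> (#|` t| <= #|` s|)%N by move=> /X_dim; lia.
(* A simplex attaining the dimension is a facet, so purity gives all facets of [X] its cardinality,
   one less than that of [Fk]. *)
have s_facet : facets X s.
  by split=> // t Xt st; apply/esym/eqP; rewrite eqEfcard st X_le.
have [|g g_facet ig] := @ex_facet X _ (nth fset0 Fs i `&` Fk)%fset X_le.
  by split; [exists i => //; exact: fsubsetIl | exact: fsubsetIr].
have gs := X_pure _ _ g_facet s_facet.
have [[[j jk gj] gk] _] := g_facet.
have /fset0Pn[v] : (Fk `\` g)%fset != fset0.
  by rewrite -cardfs_gt0 cardfsDS //; lia.
rewrite inE => /andP[vg vk].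
exists j, v; split=> //.
  by apply: contra vg => vi; apply: (fsubsetP ig); rewrite inE vi.
suff <- : g = (Fk `\ v)%fset by [].
apply/eqP; rewrite eqEfcard; apply/andP; split.
  by rewrite fsubsetD1 gk.
by have := cardfsD1 v Fk; rewrite vk; lia.
Qed.

(** Exchange puts every simplex of [X] inside some [Fk] minus a vertex that is itself in [X], so the
    facets of [X] all have this form. *)
Lemma exchange_shelling K Fs : uniq Fs -> (forall F, F \in Fs <-> facets K F) ->
  shelling_exchange Fs -> shelling K Fs.
Proof.
move=> Fs_uniq Fs_facets Fs_exch; split=> // k /andP[k_gt0 kFs] Fk X.
have X_below s : X s ->
    exists v, [/\ v \in Fk, (s `<=` Fk `\ v)%fset & X (Fk `\ v)%fset].
  move=> [[i ik si] sk]; have [|j [v [jk vk vi kj]]] := Fs_exch i k.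
    by rewrite kFs andbT.
  exists v; split=> //; last by split; [exists j | exact: fsubD1set].
  by rewrite fsubsetD1 sk; apply: contra vi; exact: (fsubsetP si).
have card_below v : v \in Fk -> #|` Fk| = #|` (Fk `\ v)%fset|.+1.
  by move=> vk; rewrite (cardfsD1 v Fk) vk.
split.
  suff card_facet F : facets X F -> #|` Fk| = #|` F|.+1.
    by move=> F G /card_facet + /card_facet; lia.
  move=> [/X_below[v [vk Fv Xv]] /(_ _ Xv Fv) <-]; exact: card_below.
split.
  (* The empty simplex is in [X] because [k > 0]; the face produced from it attains the
     dimension. *)
  have /X_below[v [vk _ Xv]] : X fset0.
    by split; [exists 0%N => //; exact: fsub0set | exact: fsub0set].
  by exists (Fk `\ v)%fset => //; have := card_below v vk; lia.
move=> s /X_below[v [/card_below ? /fsubset_leq_card ? _]]; lia.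
Qed.

End ShellingCriterion.

(** * Simplices of a join rebuilt from their slices *)

Section Unslice.
Variables (T : choiceType) (m : nat).
Implicit Types (G : 'I_m -> {fset T}) (s : {fset 'I_m * T}).

Definition unslice G : {fset 'I_m * T} :=
  (\bigcup_(i <- enum 'I_m) [fset (i, v) | v in G i])%fset.

Lemma in_unslice G i v : ((i, v) \in unslice G) = (v \in G i).
Proof.
apply/bigfcupP/idP => [[j _ /imfsetP[w /= wG [-> ->]]]//|vG].
by exists i; rewrite ?mem_enum //; apply/imfsetP; exists v.
Qed.

Lemma slice_unslice G i : slice i (unslice G) = G i.
Proof. by apply/fsetP => v; rewrite in_slice in_unslice. Qed.

Lemma sub_unslice G s :
  (forall i, (slice i s `<=` G i)%fset) -> (s `<=` unslice G)%fset.
Proof.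
move=> sG; apply/fsubsetP => -[i v]; rewrite -in_slice in_unslice.
exact: (fsubsetP (sG i)).
Qed.

Lemma slice_inj s t : (forall i, slice i s = slice i t) -> s = t.
Proof. by move=> st; apply/fsetP => -[i v]; rewrite -!in_slice st. Qed.

End Unslice.

(** * Positions in a list sorted by weight *)

Section SortedBy.
Variables (A : eqType) (w : A -> nat) (x0 : A).

Let le_w := relpre w leq.

Lemma nth_sort_le (s : seq A) i k : (i < k < size s)%N ->
  (w (nth x0 (sort le_w s) i) <= w (nth x0 (sort le_w s) k))%N.
Proof.
move=> /andP[ik ks]; have le_trans : transitive le_w by move=> ? ? ?; exact: leq_trans.
apply: (sorted_ltn_nth le_trans x0) => //; rewrite ?inE ?size_sort //.
  by apply: sort_sorted => a b; exact: leq_total.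
exact: ltn_trans ks.
Qed.

Lemma nth_sort_lt (s : seq A) k a : (k < size s)%N -> a \in s ->
  (w a < w (nth x0 (sort le_w s) k))%N ->
  exists2 j, (j < k)%N & nth x0 (sort le_w s) j = a.
Proof.
move=> ks; rewrite -(mem_sort le_w) => a_s lt_a.
have := a_s; rewrite -index_mem size_sort => js.
exists (index a (sort le_w s)); last exact: nth_index.
case: ltngtP => // kj; last by rewrite -kj nth_index ?ltnn in lt_a.
have := @nth_sort_le s k (index a (sort le_w s)).
by rewrite kj js nth_index // leqNgt lt_a => /(_ isT).
Qed.

End SortedBy.

(** * Facets of the polyhedral join and their exchange property *)

Section PolyhedralJoin.
Variables (T : choiceType) (m : nat) (M : complex 'I_m) (K L : complex T).
Hypotheses (LK : simplices L `<=` simplices K) (facets_LK : facets L `<=` facets K).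
Variable Fs : seq {fset T}.
Hypothesis Fs_shelling : shelling K Fs.
Hypothesis Fs_lt : forall tau sigma,
  facets L tau -> (facets K `\` facets L) sigma -> shelling_lt Fs tau sigma.

(** A tuple of facets of [K] is recorded by positions in the shelling, which makes the tuples a
    finite type and gives each a numerical weight. *)
Local Notation code := {ffun 'I_m -> 'I_(size Fs)}.
Implicit Type f : code.

Definition code_coord f i : {fset T} := nth fset0 Fs (f i).

Definition code_simplex f : {fset 'I_m * T} := unslice (code_coord f).

Definition code_outside f : {fset 'I_m} :=
  [fset i in enum 'I_m | ~~ `[< simplices L (code_coord f i) >]]%fset.

Definition code_ok f : bool := `[< simplices M (code_outside f) >].

Definition code_weight f : nat := \sum_i f i.

Lemma in_code_outside f i : (i \in code_outside f) = ~~ `[< simplices L (code_coord f i) >].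
Proof. by rewrite !inE /= mem_enum. Qed.

Lemma code_coord_facet f i : facets K (code_coord f i).
Proof. by have [_ Fs_facets _] := Fs_shelling; apply/Fs_facets; exact: mem_nth. Qed.

Lemma code_simplex_inj : injective code_simplex.
Proof.
have [Fs_uniq _ _] := Fs_shelling.
move=> f g fg; apply/ffunP => i; apply/val_inj/eqP => /=.
rewrite -(nth_uniq fset0 _ _ Fs_uniq) // -/(code_coord f i) -/(code_coord g i).
by rewrite -!slice_unslice -/(code_simplex f) fg.
Qed.

Lemma facets_polyjoinP s :
  facets (polyjoin M K L) s <-> exists2 f, code_ok f & s = code_simplex f.
Proof.
have [_ Fs_facets _] := Fs_shelling; split.
  move=> [[S MS sS] s_max].
  (* Each slice grows to a facet of [K] or, outside [S], of [L]; the latter is again a facet of [K],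
     hence occurs in [Fs]. *)
  have cover i : exists j : 'I_(size Fs), (slice i s `<=` nth fset0 Fs j)%fset /\
      (i \notin S -> simplices L (nth fset0 Fs j)).
    have [F KF [sF LF]] : exists2 F, facets K F &
        (slice i s `<=` F)%fset /\ (i \notin S -> simplices L F).
      have := sS i; case: ifP => iS /ex_complex_facet[F FX sF]; exists F => //.
        by apply: facets_LK.
      by split=> // _; case: FX.
    have FFs : F \in Fs by apply/Fs_facets.
    have jFs : (index F Fs < size Fs)%N by rewrite index_mem.
    by exists (Ordinal jFs); rewrite /= nth_index.
  have [g gP] := choice cover; pose f : code := finfun g.
  have coordE i : code_coord f i = nth fset0 Fs (g i) by rewrite /code_coord ffunE.
  exists f.
    apply/asboolP; apply: complex_sub MS; apply/fsubsetP => i.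
    rewrite in_code_outside; apply: contraR => iS; apply/asboolP.
    by rewrite coordE; exact: (gP i).2.
  apply/esym/s_max.
    exists S => // i; rewrite /code_simplex slice_unslice.
    case: ifP => iS; first exact: (code_coord_facet f i).1.
    by rewrite coordE; apply: (gP i).2; rewrite iS.
  by apply: sub_unslice => i; rewrite coordE; exact: (gP i).1.
move=> [f /asboolP Mf ->]; split.
  exists (code_outside f) => // i; rewrite /code_simplex slice_unslice in_code_outside.
  by case: asboolP => //= _; exact: (code_coord_facet f i).1.
(* Whatever [S] is, each slice of [G] lies in [K] and contains a facet of [K], so it equals that
   facet. *)
move=> G [S _ GS] fG; apply: slice_inj => i; rewrite slice_unslice.
apply: (code_coord_facet f i).2; last by rewrite -(slice_unslice (code_coord f) i) slice_sub.
by have := GS i; case: ifP => // _; exact: LK.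
Qed.

(** A facet of [K] lying in [L] is a facet of [L], and these form an initial segment of the
    shelling. *)
Lemma shelling_closed_L (j k : 'I_(size Fs)) : (j < k)%N ->
  simplices L (nth fset0 Fs k) -> simplices L (nth fset0 Fs j).
Proof.
have [Fs_uniq Fs_facets _] := Fs_shelling => jk Lk; apply: contrapT => Lj.
have Kfacet (i : 'I_(size Fs)) : facets K (nth fset0 Fs i).
  by apply/Fs_facets; exact: mem_nth.
have KLj : (facets K `\` facets L) (nth fset0 Fs j) by split=> // -[].
have := Fs_lt (facets_subset LK (Kfacet k) Lk) KLj.
by rewrite /shelling_lt !index_uniq // ltnNge ltnW.
Qed.

Lemma code_exchange f f' : code_ok f -> f' != f ->
  (code_weight f' <= code_weight f)%N ->
  exists g v, [/\ code_ok g, (code_weight g < code_weight f)%N,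
    v \in code_simplex f, v \notin code_simplex f' &
    (code_simplex f `\ v `<=` code_simplex g)%fset].
Proof.
move=> /asboolP Mf f'f f'_le.
(* Otherwise [f <= f'] componentwise, and the weight bound forces equality in every coordinate. *)
have [i lt_i] : exists i, (f' i < f i)%N.
  apply: contrapT => /forallNP f_le; move/eqP: f'f; apply.
  have fi_le i : (f i <= f' i)%N by rewrite leqNgt; apply/negP.
  have : code_weight f = code_weight f'.
    by apply/eqP; rewrite eqn_leq f'_le andbT; apply: leq_sum => i _.
  have [_ /esym sum_eq] := leqif_sum (fun i (_ : true) => leqif_eq (fi_le i)).
  rewrite /code_weight => /eqP; rewrite -sum_eq => /forall_inP eq_f.
  by apply/ffunP => i; apply/val_inj/esym/eqP; exact: eq_f.
have [|j [v [ji vf vf' f_sub]]] := shelling_has_exchange Fs_shelling (i := f' i) (k := f i).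
  by rewrite lt_i /=.
have jFs : (j < size Fs)%N by exact: ltn_trans (ltn_ord (f i)).
pose g : code := [ffun i' => if i' == i then Ordinal jFs else f i'].
have gi : g i = Ordinal jFs by rewrite ffunE eqxx.
have gE i' : i' != i -> g i' = f i' by rewrite ffunE => /negbTE ->.
exists g, (i, v); split; rewrite ?in_unslice //.
(* Moving coordinate [i] earlier cannot leave [L], so the outside set of [g] is contained in that of
   [f]. *)
- apply/asboolP; apply: complex_sub Mf; apply/fsubsetP => i'.
  rewrite !in_code_outside /code_coord; apply: contra.
  have [->|/gE ->//] := eqVneq i' i; rewrite gi => /asboolP Lf; apply/asboolP.
  exact: shelling_closed_L Lf.
- rewrite /code_weight (bigD1 i) //= [ltnRHS](bigD1 i) //= gi /=.
  by rewrite (eq_bigr (fun i' => nat_of_ord (f i'))) ?ltn_add2r // => i' /gE ->.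
- apply/fsubsetP => -[i' u]; rewrite !inE !in_unslice xpair_eqE /code_coord.
  have [->|/gE ->] := eqVneq i' i; last by case/andP.
  by rewrite gi /= => uf; apply: (fsubsetP f_sub); rewrite !inE.
Qed.

Lemma polyjoin_shellable : shellable (polyjoin M K L).
Proof.
pose codes := [seq f <- enum {: code} | code_ok f].
pose sorted_codes := sort (relpre code_weight leq) codes.
have codes_uniq : uniq sorted_codes by rewrite sort_uniq filter_uniq ?enum_uniq.
have mem_codes f : (f \in codes) = code_ok f by rewrite mem_filter mem_enum andbT.
exists (map code_simplex sorted_codes); apply: exchange_shelling.
- by rewrite map_inj_uniq //; exact: code_simplex_inj.
- move=> F; rewrite facets_polyjoinP; split=> [/mapP[f]|[f f_ok ->]].
    by rewrite mem_sort mem_codes => f_ok ->; exists f.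
  by rewrite mem_map ?mem_sort ?mem_codes //; exact: code_simplex_inj.
- move=> i k; rewrite size_map => /andP[ik ks].
  have is_ := ltn_trans ik ks.
  (* The type of codes may be empty, so the default [f0] for [nth] is taken from the list itself. *)
  have /hasP[f0 _ _] : has predT sorted_codes by rewrite has_predT (leq_ltn_trans _ ks).
  have ks' : (k < size codes)%N by rewrite -(size_sort (relpre code_weight leq)).
  have [||| g [v [g_ok g_lt vk vi kg]]] := @code_exchange
      (nth f0 sorted_codes k) (nth f0 sorted_codes i).
  + by rewrite -mem_codes -(mem_sort (relpre code_weight leq)) mem_nth.
  + by rewrite nth_uniq // ltn_eqF.
  + by apply: nth_sort_le; rewrite ik.
  (* Strictly smaller weight places [g] earlier, however ties are ordered. *)
  have [|j jk gE] := nth_sort_lt ks' (a := g) _ g_lt; first by rewrite mem_codes.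
  exists j, v; rewrite !(nth_map f0) ?gE //.
  exact: ltn_trans ks.
Qed.

End PolyhedralJoin.

Theorem theorem4p1 (m : nat) (m_gt0 : (0 < m)%N)
  (M : complex 'I_m) (VM : vertices M = [set: 'I_m])
  (T : choiceType) (K L : complex T) (LK : simplices L `<=` simplices K)
  (K_shellable : shellable K)
  (facets_LK : facets L `<=` facets K)
  (shelling_LK : exists2 Fs : seq {fset T}, shelling K Fs &
    forall tau sigma : {fset T}, facets L tau -> (facets K `\` facets L) sigma ->
      shelling_lt Fs tau sigma) :
  shellable (polyjoin M K L).
Proof.
by have [Fs Fs_shelling Fs_lt] := shelling_LK; exact: polyjoin_shellable Fs_shelling Fs_lt.
Qed.
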